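(* Let $K$ be a field, let $S=K[x_1,\ldots,x_n]$ be the polynomial ring with its standard grading and graded maximal ideal $\mathfrak m=(x_1,\ldots,x_n)$, and let $I\subset S$ be a proper graded ideal. If all powers $I^k$, $k\ge 1$, have a linear resolution, then $I$ satisfies the strong persistence property with respect to $\mathfrak m$.
   Context: Let $R$ be a Noetherian ring, $I\subset R$ a proper ideal and $P$ a prime ideal containing $I$. Let $\mathfrak m_P$ denote the maximal ideal of $R_P$ and $I_P=IR_P$. The ideal $I$ satisfies the strong persistence property with respect to $P$ if for all integers $k\ge 1$ and all $f\in (I_P^k:\mathfrak m_P)\setminus I_P^k$ there exists $g\in I_P$ such that $fg\notin I_P^{k+1}$. A graded ideal $J\subset S$ has a linear resolution if $J$ is generated in a single degree $e$ and, for all $i$, the $i$-th free module in its minimal graded free resolution is a direct sum of copies of $S(-e-i)$. *)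

(* Defs.v *)
From HB Require Import structures.
From mathcomp Require Import all_boot all_order all_algebra ring.
From mathcomp Require Import ring_quotient generic_quotient.
From mathcomp Require Import boolp classical_sets.
From mathcomp Require Import mpoly.

Set Implicit Arguments.
Unset Strict Implicit.
Unset Printing Implicit Defensive.

Import GRing.Theory.

Local Open Scope ring_scope.
Local Open Scope quotient_scope.
Local Open Scope classical_set_scope.

(* Ideals are sets [A : set R], possibly equal to R; MathComp's [idealr R] and
   [prime_idealr R] are the proper and the prime ideals. *)
Section IdealArithmetic.
Variable R : comNzRingType.
Implicit Types (A B I J : set R).

Definition is_ideal A :=
  A 0 /\ forall a u v, A u -> A v -> A (a * u + v).

Definition ideal_gen A : set R := smallest is_ideal A.

Definition ideal_mul I J : set R := ideal_gen [set a * b | a in I & b in J].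

Definition ideal_pow I (k : nat) : set R := iter k (ideal_mul I) setT.

Definition ideal_colon I J : set R := [set x | forall y, J y -> I (x * y)].

Lemma ideal_gen_ideal A : is_ideal (ideal_gen A).
Proof.
split=> [B [[B0 _] _] //|a u v Au Av B BA].
by have [[_ BD] _] := BA; apply: BD; [apply: Au|apply: Av].
Qed.

Lemma sub_ideal_gen A : A `<=` ideal_gen A.
Proof. by move=> x Ax B [_]; apply. Qed.

Lemma ideal_gen_sub A J : is_ideal J -> A `<=` J -> ideal_gen A `<=` J.
Proof. by move=> iJ AJ x; apply. Qed.

Lemma ideal_mulr J a u : is_ideal J -> J u -> J (a * u).
Proof. by case=> J0 JD Ju; rewrite -[_ * _]addr0; apply: JD. Qed.

Lemma ideal_add J u v : is_ideal J -> J u -> J v -> J (u + v).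
Proof. by case=> J0 JD Ju Jv; rewrite -[u]mul1r; apply: JD. Qed.

Lemma ideal_sum J (T : Type) (r : seq T) (Q : pred T) (F : T -> R) :
  is_ideal J -> (forall i, Q i -> J (F i)) -> J (\sum_(i <- r | Q i) F i).
Proof. by move=> iJ JF; elim/big_ind: _ => //; [case: iJ|move=> *; exact: ideal_add]. Qed.

End IdealArithmetic.

(* The localization of a (not necessarily integral) commutative ring at a
   prime ideal P: pairs a / s with s outside P, where a / s = b / t when
   u (a t - b s) = 0 for some u outside P. *)
Section Localization.
Variables (R : comNzRingType) (P : prime_idealr R).

Definition loc_pair := {x : R * R | x.2 \notin P}.

HB.instance Definition _ := Choice.on loc_pair.

Implicit Types x y z : loc_pair.

Local Notation num x := (val x).1.
Local Notation den x := (val x).2.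

Fact loc_den1 : (1 : R) \notin P. Proof. by rewrite idealr1. Qed.

Fact loc_denM s t : s \notin P -> t \notin P -> s * t \notin P.
Proof. by rewrite prime_idealrM negb_or => -> ->. Qed.

Definition loc_mk (a s : R) (Ps : s \notin P) : loc_pair :=
  exist (fun x : R * R => x.2 \notin P) (a, s) Ps.

Definition loc_equiv x y : bool :=
  `[< exists2 u, u \notin P & u * (num x * den y - num y * den x) = 0 >].

Fact loc_equiv_refl : reflexive loc_equiv.
Proof.
by move=> x; apply/asboolP; exists 1; rewrite ?loc_den1 // subrr mulr0.
Qed.

Fact loc_equiv_sym : ssrbool.symmetric loc_equiv.
Proof.
suff sym x y : loc_equiv x y -> loc_equiv y x by move=> x y; apply/idP/idP; apply: sym.
move=> /asboolP[u Pu e]; apply/asboolP; exists u => //.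
by rewrite -opprB mulrN e oppr0.
Qed.

Fact loc_equiv_trans : transitive loc_equiv.
Proof.
move=> y x z /asboolP[u Pu e1] /asboolP[v Pv e2]; apply/asboolP.
exists (u * v * den y); first by rewrite !loc_denM ?(valP y).
rewrite [LHS](_ : _ =
  v * den z * (u * (num x * den y - num y * den x)) +
  u * den x * (v * (num y * den z - num z * den y))); last by ring.
by rewrite e1 e2 !mulr0 addr0.
Qed.

Canonical loc_equiv_equiv :=
  EquivRel loc_equiv loc_equiv_refl loc_equiv_sym loc_equiv_trans.

Definition localization := {eq_quot loc_equiv}.

HB.instance Definition _ : EqQuotient _ loc_equiv localization :=
  EqQuotient.on localization.
HB.instance Definition _ := Choice.on localization.

Definition loc_frac (a s : R) (Ps : s \notin P) : localization :=
  \pi_localization (loc_mk a Ps).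

Lemma loc_fracP x y :
  (\pi_localization x = \pi_localization y) <->
  exists2 u, u \notin P & u * (num x * den y - num y * den x) = 0.
Proof.
split=> [/eqmodP/asboolP //|H]; apply/eqmodP; exact/asboolP.
Qed.

Lemma loc_frac_eq a s b t (Ps : s \notin P) (Pt : t \notin P) :
  loc_frac a Ps = loc_frac b Pt <->
  exists2 u, u \notin P & u * (a * t - b * s) = 0.
Proof. exact: loc_fracP. Qed.

Lemma loc_frac_surj (q : localization) :
  exists a s (Ps : s \notin P), q = loc_frac a Ps.
Proof.
elim/quotW: q => -[[a s] /= Ps]; exists a, s, Ps; congr (\pi_ _); exact: val_inj.
Qed.

Definition loc_addf x y : loc_pair :=
  loc_mk (num x * den y + num y * den x) (loc_denM (valP x) (valP y)).
Definition loc_oppf x : loc_pair := loc_mk (- num x) (valP x).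
Definition loc_mulf x y : loc_pair :=
  loc_mk (num x * num y) (loc_denM (valP x) (valP y)).

Definition loc_add := lift_op2 localization loc_addf.
Definition loc_opp := lift_op1 localization loc_oppf.
Definition loc_mul := lift_op2 localization loc_mulf.

Fact loc_reprP x : exists2 u, u \notin P &
  u * (num x * den (repr (\pi_localization x)) -
       num (repr (\pi_localization x)) * den x) = 0.
Proof. by apply/loc_fracP; rewrite reprK. Qed.

Fact pi_loc_add : {morph \pi_localization : x y / loc_addf x y >-> loc_add x y}.
Proof.
move=> x y; unlock loc_add; apply/loc_fracP => /=.
have [u Pu e1] := loc_reprP x; have [v Pv e2] := loc_reprP y.
move: (repr _) e1 => x' e1; move: (repr _) e2 => y' e2.
exists (u * v); first exact: loc_denM.
rewrite [LHS](_ : _ =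
  v * den y * den y' * (u * (num x * den x' - num x' * den x)) +
  u * den x * den x' * (v * (num y * den y' - num y' * den y))); last by ring.
by rewrite e1 e2 !mulr0 addr0.
Qed.
Canonical pi_loc_add_morph := PiMorph2 pi_loc_add.

Fact pi_loc_opp : {morph \pi_localization : x / loc_oppf x >-> loc_opp x}.
Proof.
move=> x; unlock loc_opp; apply/loc_fracP => /=.
have [u Pu e1] := loc_reprP x; move: (repr _) e1 => x' e1.
exists u => //.
rewrite [LHS](_ : _ = - (u * (num x * den x' - num x' * den x))); last by ring.
by rewrite e1 oppr0.
Qed.
Canonical pi_loc_opp_morph := PiMorph1 pi_loc_opp.

Fact pi_loc_mul : {morph \pi_localization : x y / loc_mulf x y >-> loc_mul x y}.
Proof.
move=> x y; unlock loc_mul; apply/loc_fracP => /=.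
have [u Pu e1] := loc_reprP x; have [v Pv e2] := loc_reprP y.
move: (repr _) e1 => x' e1; move: (repr _) e2 => y' e2.
exists (u * v); first exact: loc_denM.
rewrite [LHS](_ : _ =
  v * num y * den y' * (u * (num x * den x' - num x' * den x)) +
  u * num x' * den x * (v * (num y * den y' - num y' * den y))); last by ring.
by rewrite e1 e2 !mulr0 addr0.
Qed.
Canonical pi_loc_mul_morph := PiMorph2 pi_loc_mul.

Lemma loc_frac_add a s b t (Ps : s \notin P) (Pt : t \notin P) :
  loc_add (loc_frac a Ps) (loc_frac b Pt) = loc_frac (a * t + b * s) (loc_denM Ps Pt).
Proof. by rewrite /loc_frac -pi_loc_add; congr (\pi_ _); exact: val_inj. Qed.

Lemma loc_frac_opp a s (Ps : s \notin P) : loc_opp (loc_frac a Ps) = loc_frac (- a) Ps.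
Proof. by rewrite /loc_frac -pi_loc_opp; congr (\pi_ _); exact: val_inj. Qed.

Lemma loc_frac_mul a s b t (Ps : s \notin P) (Pt : t \notin P) :
  loc_mul (loc_frac a Ps) (loc_frac b Pt) = loc_frac (a * b) (loc_denM Ps Pt).
Proof. by rewrite /loc_frac -pi_loc_mul; congr (\pi_ _); exact: val_inj. Qed.

Definition loc_of (a : R) : localization := loc_frac a loc_den1.

Fact loc_frac_ext a s b t (Ps : s \notin P) (Pt : t \notin P) :
  a * t = b * s -> loc_frac a Ps = loc_frac b Pt.
Proof.
by move=> e; apply/loc_frac_eq; exists 1; rewrite ?loc_den1 // e subrr mulr0.
Qed.

Fact loc_addA : associative loc_add.
Proof.
move=> q r w; have [a [s [Ps ->]]] := loc_frac_surj q.
have [b [t [Pt ->]]] := loc_frac_surj r; have [c [v [Pv ->]]] := loc_frac_surj w.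
by rewrite !loc_frac_add; apply: loc_frac_ext; ring.
Qed.

Fact loc_addC : commutative loc_add.
Proof.
move=> q r; have [a [s [Ps ->]]] := loc_frac_surj q.
have [b [t [Pt ->]]] := loc_frac_surj r.
by rewrite !loc_frac_add; apply: loc_frac_ext; ring.
Qed.

Fact loc_add0 : left_id (loc_of 0) loc_add.
Proof.
move=> q; have [a [s [Ps ->]]] := loc_frac_surj q.
by rewrite loc_frac_add; apply: loc_frac_ext; ring.
Qed.

Fact loc_addN : left_inverse (loc_of 0) loc_opp loc_add.
Proof.
move=> q; have [a [s [Ps ->]]] := loc_frac_surj q.
by rewrite loc_frac_opp loc_frac_add; apply: loc_frac_ext; ring.
Qed.

HB.instance Definition _ :=
  GRing.isZmodule.Build localization loc_addA loc_addC loc_add0 loc_addN.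

Fact loc_mulA : associative loc_mul.
Proof.
move=> q r w; have [a [s [Ps ->]]] := loc_frac_surj q.
have [b [t [Pt ->]]] := loc_frac_surj r; have [c [v [Pv ->]]] := loc_frac_surj w.
by rewrite !loc_frac_mul; apply: loc_frac_ext; ring.
Qed.

Fact loc_mulC : commutative loc_mul.
Proof.
move=> q r; have [a [s [Ps ->]]] := loc_frac_surj q.
have [b [t [Pt ->]]] := loc_frac_surj r.
by rewrite !loc_frac_mul; apply: loc_frac_ext; ring.
Qed.

Fact loc_mul1 : left_id (loc_of 1) loc_mul.
Proof.
move=> q; have [a [s [Ps ->]]] := loc_frac_surj q.
by rewrite loc_frac_mul; apply: loc_frac_ext; ring.
Qed.

Fact loc_mulDl : left_distributive loc_mul loc_add.
Proof.
move=> q r w; have [a [s [Ps ->]]] := loc_frac_surj q.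
have [b [t [Pt ->]]] := loc_frac_surj r; have [c [v [Pv ->]]] := loc_frac_surj w.
by rewrite !(loc_frac_mul, loc_frac_add); apply: loc_frac_ext; ring.
Qed.

Fact loc_1neq0 : loc_of 1 != loc_of 0.
Proof.
apply/eqP => /loc_frac_eq[u Pu]; rewrite !mulr1 subr0 mulr1 => u0.
by move: Pu; rewrite u0 rpred0.
Qed.

HB.instance Definition _ := GRing.Zmodule_isComNzRing.Build localization
  loc_mulA loc_mulC loc_mul1 loc_mulDl loc_1neq0.

(* The extension I R_P of an ideal I of R. *)
Definition loc_ideal (I : set R) : set localization :=
  ideal_gen [set loc_of a | a in I].

(* m_P = P R_P *)
Definition loc_max : set localization := loc_ideal [set` P].

Lemma loc_idealE (I : set R) (q : localization) : is_ideal I ->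
  loc_ideal I q <-> exists a s (Ps : s \notin P), I a /\ q = loc_frac a Ps.
Proof.
move=> iI; split; last first.
  move=> [a [s [Ps [Ia ->]]]].
  rewrite (_ : loc_frac a Ps = loc_frac 1 Ps * loc_of a).
    by apply: (@ideal_mulr _ (loc_ideal I)); [exact: ideal_gen_ideal|apply: sub_ideal_gen; exists a].
  by rewrite [RHS]loc_frac_mul; apply: loc_frac_ext; ring.
pose J := [set w | exists a s (Ps : s \notin P), I a /\ w = loc_frac a Ps].
suff H : loc_ideal I `<=` J by exact: H.
apply: ideal_gen_sub; last by move=> _ [a Ia <-]; exists a, 1, loc_den1.
split; first by exists 0, 1, loc_den1; split=> //; case: iI.
move=> w _ _ [a [s [Ps [Ia ->]]]] [b [t [Pt [Ib ->]]]].
have [c [v [Pv ->]]] := loc_frac_surj w.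
exists (c * a * t + b * (v * s)), (v * s * t), (loc_denM (loc_denM Pv Ps) Pt).
split; last by rewrite [_ * _]loc_frac_mul [_ + _]loc_frac_add.
rewrite [_ * t]mulrC [b * _]mulrC; apply: (@ideal_add _ I) => //.
  by do 2!apply: (@ideal_mulr _ I) => //.
by apply: (@ideal_mulr _ I).
Qed.

Fact prime_is_ideal : is_ideal [set` P].
Proof.
split=> [|a u v Pu Pv] /=; first exact: rpred0.
by rewrite rpredD // idealMr.
Qed.

(* [loc_max] is the unique maximal ideal of R_P. *)
Lemma loc_max_proper : ~ loc_max 1.
Proof.
move=> /(loc_idealE _ prime_is_ideal)[a [s [Ps [/= Pa]]]].
move=> /loc_frac_eq[u Pu e].
have : u * (1 * s) \in P.
  move/eqP: e; rewrite mulrBr subr_eq0 => /eqP ->.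
  by rewrite mulr1 idealMr.
by rewrite mul1r prime_idealrM (negPf Pu) (negPf Ps).
Qed.

Lemma loc_max_max (J : set localization) : is_ideal J -> ~ J 1 -> J `<=` loc_max.
Proof.
move=> iJ J1 q Jq; have [a [s [Ps qE]]] := loc_frac_surj q.
apply/(loc_idealE _ prime_is_ideal); exists a, s, Ps; split=> //=.
apply: contrapT => /negP Pa; apply: J1.
rewrite (_ : 1 = loc_frac s Pa * q); first exact: ideal_mulr.
by rewrite qE [RHS]loc_frac_mul; apply: loc_frac_ext; ring.
Qed.

End Localization.

Arguments loc_ideal [R] P I.
Arguments loc_max [R] P.

(* Meant for R Noetherian and P containing I; neither is needed to state it. *)
Definition strong_persistence (R : comNzRingType) (I : idealr R)
    (P : prime_idealr R) :=
  let IP := loc_ideal P [set` I] in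
  forall k : nat, (1 <= k)%N -> forall f : localization P,
    ideal_colon (ideal_pow IP k) (loc_max P) f -> ~ ideal_pow IP k f ->
    exists2 g, IP g & ~ ideal_pow IP k.+1 (f * g).

Section GradedIdeals.
Variables (K : fieldType) (n : nat).
Local Notation S := {mpoly K[n]}.

Definition irrelevant_ideal : set S := ideal_gen (range (fun i : 'I_n => 'X_i)).

Definition graded_max : {pred S} := fun p => `[< irrelevant_ideal p >].

Fact mcoeff0M (p q : S) : (p * q)@_0 = p@_0 * q@_0.
Proof. exact: (mcoeff0_is_multiplicative n K).1. Qed.

Lemma irrelevant_idealE (p : S) : irrelevant_ideal p <-> p@_0 = 0.
Proof.
split.
  suff H : irrelevant_ideal `<=` [set q : S | q@_0 = 0] by exact: H.
  apply: ideal_gen_sub.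
    split=> [|a u v /= u0 v0]; first exact: mcoeff0.
    by rewrite mcoeffD mcoeff0M u0 v0 mulr0 addr0.
  by move=> _ [i _ <-] /=; rewrite mcoeffX mnm1_eq0.
move=> p0; rewrite [p]mpolyE; apply: (@ideal_sum _ irrelevant_ideal) => [|m _].
  exact: ideal_gen_ideal.
have [->|/eqP m0] := eqVneq m 0%MM.
  by rewrite p0 scale0r; case: (ideal_gen_ideal (range (fun i : 'I_n => 'X_i : S))).
have [i mi] : exists i, m i != 0%N.
  apply: contrapT => H; apply: m0; apply/mnmP => i; rewrite mnm0E.
  by apply/eqP; apply: contrapT => /negP mi; apply: H; exists i.
rewrite -(@submK _ U_(i)%MM m) ?lep1mP //.
rewrite mpolyXD scalerAl; apply: (@ideal_mulr _ irrelevant_ideal); first exact: ideal_gen_ideal.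
by apply: sub_ideal_gen; exists i.
Qed.

Fact graded_max_ideal : idealr_closed graded_max.
Proof.
split; first by apply/asboolP/irrelevant_idealE; rewrite mcoeff0.
  by apply/negP => /asboolP/irrelevant_idealE/eqP; rewrite mcoeff1 eqxx oner_eq0.
move=> a u v /asboolP mu /asboolP mv; apply/asboolP.
by case: (ideal_gen_ideal (range (fun i : 'I_n => 'X_i : S))) => _; apply.
Qed.

Fact graded_max_prime : prime_idealr_closed graded_max.
Proof.
move=> u v /asboolP/irrelevant_idealE/eqP.
rewrite mcoeff0M mulf_eq0 => /orP[] /eqP w0; apply/orP.
  by left; apply/asboolP/irrelevant_idealE.
by right; apply/asboolP/irrelevant_idealE.
Qed.

HB.instance Definition _ := isIdealr.Build S graded_max graded_max_ideal.
HB.instance Definition _ := isPrimeIdealrClosed.Build S graded_max graded_max_prime.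

Definition graded_ideal (J : set S) :=
  forall p, J p -> forall d : nat, J (pihomog mdeg d p).

Definition generated_in_degree (J : set S) (e : nat) :=
  J = ideal_gen (J `&` [set p | p \is e.-homog]).

(* S is zero in negative degrees. *)
Definition homog_of_degree (z : int) (p : S) : Prop :=
  if z is Posz d then p \is d.-homog else p = 0.

(* F_i = S(-a_0) + ... + S(-a_(r-1)), with r = gfr_rank i and a_j =
   gfr_shift i j, is the module of row vectors of length r: the j-th basis
   vector has degree a_j. Matrices act on the right, gfr_aug is the
   augmentation F_0 -> J, and gfr_diff i is the map F_(i+1) -> F_i. *)
Record graded_free_resolution (J : set S) := GradedFreeResolution {
  gfr_rank : nat -> nat;
  gfr_shift : forall i, 'I_(gfr_rank i) -> int;
  gfr_aug : 'cV[S]_(gfr_rank 0);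
  gfr_diff : forall i, 'M[S]_(gfr_rank i.+1, gfr_rank i);
  gfr_aug_homog : forall j, homog_of_degree (gfr_shift j) (gfr_aug j 0);
  gfr_diff_homog : forall i j l,
    homog_of_degree (gfr_shift j - gfr_shift l) (gfr_diff i j l);
  gfr_aug_image : range (fun v : 'rV_(gfr_rank 0) => (v *m gfr_aug) 0 0) = J;
  gfr_exact0 : forall v : 'rV_(gfr_rank 0),
    v *m gfr_aug = 0 <-> exists w, v = w *m gfr_diff 0;
  gfr_exact : forall i (v : 'rV_(gfr_rank i.+1)),
    v *m gfr_diff i = 0 <-> exists w, v = w *m gfr_diff i.+1 }.

(* F_(i+1) is mapped into m F_i. *)
Definition minimal_resolution (J : set S) (F : graded_free_resolution J) :=
  forall i j l, irrelevant_ideal (gfr_diff F i j l).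

(* A minimal graded free resolution is unique up to isomorphism, so it is
   harmless to ask for one with the right shifts. *)
Definition linear_resolution (J : set S) :=
  exists e : nat, generated_in_degree J e /\
    exists F : graded_free_resolution J, minimal_resolution F /\
      forall i (j : 'I_(gfr_rank F i)), gfr_shift j = (e + i)%:Z.

End GradedIdeals.

Arguments graded_max K n : clear implicits.

(* Main.v *)
Require Import Defs.
From mathcomp Require Import all_boot all_order all_algebra.
From mathcomp Require Import ring_quotient boolp classical_sets.
From mathcomp Require Import mpoly.
From mathcomp Require Import ring.

(* The heart of the matter is that if J has a linear resolution and is
   generated in degree e, then the socle of S/J lives in degree e - 1. This is
   proved without Tor, by killing the variables one at a time: for a socle
   element z and the first variable x, write x z = v D_0 with D_0 the
   augmentation; then v is, modulo x, a socle element for the complex shifted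
   by one and reduced modulo x, and v in the image of D_1 modulo x forces z
   in the image of D_0. If z has degree >= e the successive v have positive
   degree, since the further differentials are linear, so the last one is zero
   once all the variables are gone.
   Hence, for a/s in (I^k : m) \ I^k in the localization, a = c + b with c
   homogeneous of degree e - 1 and b in I^k, where e is the initial degree of
   I^k. If g is a nonzero element of I of its initial degree d, then c g is
   nonzero of degree e + d - 1 < e + d, so it is not in I^(k+1). *)

Set Implicit Arguments.
Unset Strict Implicit.
Unset Printing Implicit Defensive.

Import GRing.Theory.

Local Open Scope ring_scope.
Local Open Scope classical_set_scope.

(** * Ideals, and matrices with entries in an ideal *)

Section Ideals.
Variable R : comNzRingType.
Implicit Types (A I J : set R).

Lemma ideal_oppr J u : is_ideal J -> J u -> J (- u).
Proof. by move=> iJ Ju; rewrite -mulN1r; apply: ideal_mulr. Qed.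

Lemma ideal_sub J u v : is_ideal J -> J u -> J v -> J (u - v).
Proof. by move=> iJ Ju Jv; apply: ideal_add => //; apply: ideal_oppr. Qed.

Lemma mem_ideal_mul I J a b : I a -> J b -> ideal_mul I J (a * b).
Proof. by move=> Ia Jb; apply: sub_ideal_gen; exists a => //; exists b. Qed.

Lemma ideal_pow_ideal I k : is_ideal (ideal_pow I k).
Proof. by case: k => [//|k]; exact: ideal_gen_ideal. Qed.

Lemma ideal_pow_sub I k : is_ideal I -> ideal_pow I k.+1 `<=` I.
Proof.
move=> iI; apply: ideal_gen_sub => // _ [a Ia [b _ <-]].
by rewrite mulrC; apply: ideal_mulr.
Qed.

Lemma idealr_is_ideal (I : idealr R) : is_ideal [set` I].
Proof. by split=> [|a u v Iu Iv] /=; [exact: rpred0|rewrite rpredD // idealMr]. Qed.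

(** Applied to a difference, this expresses congruence modulo [A] without forming a quotient
    ring. *)
Definition mx_in A p q (M : 'M[R]_(p, q)) := forall i j, A (M i j).

Section MxIn.
Variables (J : set R) (iJ : is_ideal J) (p q : nat).
Implicit Types M N : 'M[R]_(p, q).

Lemma mx_inD M N : mx_in J M -> mx_in J N -> mx_in J (M + N).
Proof. by move=> JM JN i j; rewrite mxE; apply: ideal_add. Qed.

Lemma mx_inN M : mx_in J M -> mx_in J (- M).
Proof. by move=> JM i j; rewrite mxE; apply: ideal_oppr. Qed.

Lemma mx_inZ a M : mx_in J M -> mx_in J (a *: M).
Proof. by move=> JM i j; rewrite mxE; apply: ideal_mulr. Qed.

Lemma mx_inZl a M : J a -> mx_in J (a *: M).
Proof. by move=> Ja i j; rewrite mxE mulrC; apply: ideal_mulr. Qed.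

Lemma mx_inMr l M (N : 'M[R]_(q, l)) : mx_in J M -> mx_in J (M *m N).
Proof.
move=> JM i j; rewrite mxE; apply: ideal_sum => // k _.
by rewrite mulrC; apply: ideal_mulr.
Qed.

End MxIn.
End Ideals.

(** * Localization and powers of ideals *)

Section LocalizedPowers.
Variables (R : comNzRingType) (P : prime_idealr R).

Lemma loc_ofM (a b : R) : loc_of P a * loc_of P b = loc_of P (a * b).
Proof. by rewrite [LHS]loc_frac_mul; apply: loc_frac_ext; ring. Qed.

Lemma loc_ofD (a b : R) : loc_of P a + loc_of P b = loc_of P (a + b).
Proof. by rewrite [LHS]loc_frac_add; apply: loc_frac_ext; ring. Qed.

(** Generators suffice: the elements that [loc_of] sends into the right-hand side form an ideal, and
    conversely (a/s)(b/t) = (ab)/(st). *)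
Lemma loc_ideal_mul (I J : set R) : is_ideal I -> is_ideal J ->
  loc_ideal P (ideal_mul I J) = ideal_mul (loc_ideal P I) (loc_ideal P J).
Proof.
move=> iI iJ; apply/seteqP; split.
  apply: ideal_gen_sub; first exact: ideal_gen_ideal.
  move=> _ [c IJc <-].
  have iM := ideal_gen_ideal
    [set a * b | a in loc_ideal P I & b in loc_ideal P J].
  suff H : ideal_mul I J `<=`
      [set c | ideal_mul (loc_ideal P I) (loc_ideal P J) (loc_of P c)].
    exact: H.
  apply: ideal_gen_sub.
    split=> [|a u v Mu Mv] /=; first by case: iM.
    rewrite -loc_ofD -loc_ofM.
    exact: (ideal_add iM (ideal_mulr _ iM Mu) Mv).
  move=> _ [a Ia [b Jb <-]] /=; rewrite -loc_ofM.
  by apply: mem_ideal_mul; apply: sub_ideal_gen; [exists a|exists b].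
apply: ideal_gen_sub; first exact: ideal_gen_ideal.
move=> c [q Iq]; have [a [s [Ps [Ia ->]]]] := (loc_idealE q iI).1 Iq.
move=> [w Jw <-]; have [b [t [Pt [Jb ->]]]] := (loc_idealE w iJ).1 Jw.
apply/loc_idealE; first exact: ideal_gen_ideal.
exists (a * b), (s * t), (loc_denM Ps Pt).
by split; [exact: mem_ideal_mul|exact: loc_frac_mul].
Qed.

Lemma loc_ideal_pow (I : set R) k : is_ideal I ->
  ideal_pow (loc_ideal P I) k = loc_ideal P (ideal_pow I k).
Proof.
move=> iI; elim: k => [|k IHk]; last first.
  rewrite /ideal_pow /= -!/(ideal_pow _ _) IHk -loc_ideal_mul //.
  exact: ideal_pow_ideal.
apply/seteqP; split=> // q _; have [a [s [Ps ->]]] := loc_frac_surj q.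
by apply/loc_idealE => //; exists a, s, Ps.
Qed.

End LocalizedPowers.

(** * Order filtration, homogeneous components and graded ideals *)

Section Polynomials.
Variables (K : fieldType) (n : nat).
Local Notation S := {mpoly K[n]}.
Implicit Types (p q : S) (m : 'X_{1..n}).

Definition monomial_ideal (A : pred 'X_{1..n}) : set S :=
  [set p | forall m, p@_m != 0 -> A m].

Lemma monomial_idealP (A : pred 'X_{1..n}) : (forall m m', A m -> A (m' + m)%MM) ->
  is_ideal (monomial_ideal A).
Proof.
move=> AD; split=> [m|a u v Au Av m]; first by rewrite mcoeff0 eqxx.
rewrite -mcoeff_msupp => /msuppD_le; rewrite mem_cat => /orP[|]; last first.
  by rewrite mcoeff_msupp; exact: Av.
case/msuppM_le/allpairsP=> -[m1 m2] /= [_ um2 ->]; apply: AD.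
by apply: Au; rewrite -mcoeff_msupp.
Qed.

(** The [d]-th power of the irrelevant ideal. *)
Definition order_ideal d := monomial_ideal (fun m => d <= mdeg m)%N.

Lemma order_idealP d : is_ideal (order_ideal d).
Proof.
by apply: monomial_idealP => m m' dm; rewrite mdegD (leq_trans dm) ?leq_addl.
Qed.

Lemma order_idealM d e p q :
  order_ideal d p -> order_ideal e q -> order_ideal (d + e)%N (p * q).
Proof.
move=> dp eq m; rewrite -mcoeff_msupp => /msuppM_le/allpairsP[[m1 m2] /=].
case; rewrite !mcoeff_msupp => pm1 qm2 ->.
by rewrite mdegD leq_add ?dp ?eq.
Qed.

Lemma homog_order_ideal d p : p \is d.-homog -> order_ideal d p.
Proof. by move=> /dhomogP hp m; rewrite -mcoeff_msupp => /hp ->. Qed.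

Lemma homog_order_ideal_eq0 d e p :
  p \is d.-homog -> order_ideal e p -> (d < e)%N -> p = 0.
Proof.
move=> /dhomogP hp ep lt_de; apply/mpolyP => m; rewrite mcoeff0.
apply/eqP; apply: contraLR lt_de => pm; rewrite -leqNgt.
by rewrite -(hp m) ?ep // mcoeff_msupp.
Qed.

Lemma mcoeff_pihomog d p m :
  (pihomog mdeg d p)@_m = if mdeg m == d then p@_m else 0.
Proof.
case: ifP => [/eqP md|/negbT]; last exact: dhomog_nemf_coeff (pihomogP _ _ _).
apply/esym/eqP; rewrite -subr_eq0 -mcoeffB pihomogE.
rewrite {1}[p]mpolyE (bigID (fun m' : 'X_{1..n} => mdeg m' == d)) /=.
rewrite addrAC subrr add0r raddf_sum big1 //= => m' /negP md'.
rewrite mcoeffZ mcoeffX; case: eqP => [mm'|]; last by rewrite mulr0.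
by case: md'; rewrite mm' md.
Qed.

Lemma pihomogM d e p q : q \is e.-homog ->
  pihomog mdeg (d + e) (p * q) = pihomog mdeg d p * q.
Proof.
move=> hq; have [k pk] : exists k, (mmeasure mdeg p <= k)%N.
  by exists (mmeasure mdeg p).
rewrite [in LHS](pihomog_partitionE pk) [in RHS](pihomog_partitionE pk).
rewrite mulr_suml !raddf_sum /= mulr_suml; apply: eq_bigr => i _ /=.
have [->|ne] := eqVneq (i : nat) d.
  by rewrite pihomog_id pihomog_dE // dhomogM // pihomogP.
rewrite (pihomog_ne0 ne) ?pihomogP // mul0r.
by rewrite (@pihomog_ne0 _ _ _ (i + e)%N) ?eqn_add2r // dhomogM ?pihomogP.
Qed.

Lemma order_ideal_pihomog d p : (forall i, (i < d)%N -> pihomog mdeg i p = 0) ->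
  order_ideal d p.
Proof.
move=> p0 m; apply: contraR; rewrite -ltnNge => /p0 pm.
by have := mcoeff_pihomog (mdeg m) p m; rewrite pm eqxx mcoeff0 => <-.
Qed.

Lemma graded_ideal_gen (A : set S) d :
  (forall p, A p -> p \is d.-homog) -> graded_ideal (ideal_gen A).
Proof.
move=> Ad p; suff H : ideal_gen A `<=`
    [set p | forall d, ideal_gen A (pihomog mdeg d p)] by exact: H.
have iA := ideal_gen_ideal A.
apply: ideal_gen_sub; last first.
  move=> q Aq e /=; have [->|ne] := eqVneq e d.
    by rewrite pihomog_dE ?Ad //; exact: sub_ideal_gen.
  by rewrite (@pihomog_ne0 _ _ _ d) ?Ad //; [case: iA|rewrite eq_sym].
split=> [e|a u v Au Av e] /=; first by rewrite pihomog0; case: iA.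
rewrite pihomogD; apply: (ideal_add iA _ (Av e)).
(* By linearity [a] may be replaced by a monomial, which merely shifts degrees. *)
rewrite [a]mpolyE mulr_suml raddf_sum; apply: (@ideal_sum _ (ideal_gen A) _ _ _ _ iA) => m _ /=.
rewrite -scalerAl linearZ /= -mul_mpolyC; apply: (ideal_mulr _ iA).
rewrite mulrC.
have hm : ('X_[m] : S) \is (mdeg m).-homog by rewrite dhomogX.
have [le_me|lt_em] := leqP (mdeg m) e.
  rewrite -(subnK le_me) pihomogM // mulrC.
  exact: (ideal_mulr _ iA).
rewrite (_ : pihomog _ _ _ = 0); first by case: iA.
apply: (@homog_order_ideal_eq0 e (mdeg m)) => //; first exact: pihomogP.
move=> m'; rewrite mcoeff_pihomog; case: ifP => _; last by rewrite eqxx.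
exact: (ideal_mulr _ (order_idealP _) (homog_order_ideal hm)).
Qed.

Lemma generated_in_degree_graded (J : set S) d :
  generated_in_degree J d -> graded_ideal J.
Proof. by move=> ->; apply: (@graded_ideal_gen _ d) => p []. Qed.

Lemma generated_in_degree_order (J : set S) d :
  generated_in_degree J d -> J `<=` order_ideal d.
Proof.
move=> ->; apply: ideal_gen_sub; first exact: order_idealP.
by move=> p [_]; exact: homog_order_ideal.
Qed.

Lemma generated_in_degree_neq0 (J : set S) d p :
  generated_in_degree J d -> J p -> p != 0 ->
  exists g, [/\ J g, g \is d.-homog & g != 0].
Proof.
move=> Jd Jp p0; apply: contrapT => H; move/eqP: p0; apply.
suff : J `<=` [set 0] by apply.
rewrite Jd; apply: ideal_gen_sub => [|g [Jg /= hg]].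
  by split=> // a u v -> ->; rewrite mulr0 addr0.
by apply/eqP; apply: contrapT => /negP g0; apply: H; exists g.
Qed.

Lemma graded_ideal_in (J : set S) p : is_ideal J ->
  (forall d, J (pihomog mdeg d p)) -> J p.
Proof.
move=> iJ Jp; have [k pk] : exists k, (mmeasure mdeg p <= k)%N by exists (mmeasure mdeg p).
by rewrite (pihomog_partitionE pk); apply: ideal_sum.
Qed.

(* Multiplication by [u] only scales the lowest component of [p] modulo terms
   of higher degree. *)
Lemma graded_ideal_unit (J : set S) u p : is_ideal J -> graded_ideal J ->
  u@_0 != 0 -> J (u * p) -> J p.
Proof.
move=> iJ gJ u0 Jup; apply: graded_ideal_in => //.
elim/ltn_ind=> d IHd.
(* The components below [d] are in [J] by induction, so [p] may be truncated to [b], of order at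
   least [d]. *)
pose b := p - \sum_(i < d) pihomog mdeg i p.
have Jub : J (u * b).
  rewrite mulrBr; apply: ideal_sub => //; apply: ideal_mulr => //.
  by apply: ideal_sum => // i _; exact: IHd.
have bE e : pihomog mdeg e b = if (e < d)%N then 0 else pihomog mdeg e p.
  rewrite pihomogB [pihomog _ _ (\sum_(_ < _) _)]raddf_sum /=; case: ifPn => [lt_ed|].
    rewrite (bigD1 (Ordinal lt_ed)) //= pihomog_id big1 ?addr0 ?subrr // => i ne.
    by rewrite (@pihomog_ne0 _ _ _ i) ?pihomogP.
  move=> le_de; rewrite big1 ?subr0 // => i _.
  rewrite (@pihomog_ne0 _ _ _ i) ?pihomogP //.
  by apply: contraNneq le_de => <-.
have bo : order_ideal d b by apply: order_ideal_pihomog => i id; rewrite bE id.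
have uo : order_ideal 1 (u - (u@_0)%:MP).
  move=> m; rewrite mcoeffB mcoeffC lt0n mdeg_eq0.
  by have [->|//] := eqVneq m 0%MM; rewrite mulr1 subrr eqxx.
have := gJ _ Jub d; rewrite -[u](subrK (u@_0)%:MP) mulrDl pihomogD.
rewrite (_ : pihomog _ _ (_ * b) = 0) ?add0r; last first.
  apply: (@homog_order_ideal_eq0 d d.+1) => //; first exact: pihomogP.
  move=> m; rewrite mcoeff_pihomog; case: ifP => _; last by rewrite eqxx.
  exact: order_idealM uo bo m.
rewrite mul_mpolyC linearZ /= bE ltnn => Jd.
rewrite -[pihomog _ _ _]scale1r -(mulVf u0) -scalerA -mul_mpolyC.
exact: ideal_mulr.
Qed.

(** * Killing the variables one at a time *)

(* The ideal generated by the variables with index less than [r]. *)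
Definition vars_ideal r :=
  monomial_ideal (fun m => [exists i : 'I_n, (i < r)%N && (m i != 0)%N]).

Lemma vars_idealP r : is_ideal (vars_ideal r).
Proof.
apply: monomial_idealP => m m' /existsP[i /andP[ir mi]].
by apply/existsP; exists i; rewrite ir mnmDE addn_eq0 negb_and mi orbT.
Qed.

Lemma vars_idealS r : vars_ideal r `<=` vars_ideal r.+1.
Proof.
move=> p rp m /rp/existsP[i /andP[ir mi]].
by apply/existsP; exists i; rewrite mi ltnW.
Qed.

Lemma vars_idealX (i : 'I_n) : vars_ideal i.+1 'X_i.
Proof.
move=> m; rewrite mcoeffX; have [<- _|_] := eqVneq U_(i)%MM m; last by rewrite eqxx.
by apply/existsP; exists i; rewrite ltnSn mnm1E eqxx.
Qed.

Lemma vars_ideal0 p : vars_ideal 0 p -> p = 0.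
Proof.
move=> p0; apply/mpolyP => m; rewrite mcoeff0; apply/eqP.
by apply: contrapT => /negP /p0/existsP[].
Qed.

(** Once all variables are killed, forms of positive degree vanish; this is the base case of
    [linear_complex_socle]. *)
Lemma homog_vars_ideal d p : (0 < d)%N -> p \is d.-homog -> vars_ideal n p.
Proof.
move=> d0 /dhomogP hp m; rewrite -mcoeff_msupp => /hp md; rewrite -md in d0.
apply: contraLR d0 => /existsPn m0; rewrite -leqNgt leqn0 mdeg_eq0.
apply/eqP/mnmP => i; rewrite mnm0E; apply/eqP.
by have := m0 i; rewrite ltn_ord negbK.
Qed.

(** Terms involving a variable before ['X_i] go to [a]; every other term must contain ['X_i], which
    is factored out. *)
Lemma vars_ideal_split (i : 'I_n) p : vars_ideal i.+1 p ->
  exists a b, vars_ideal i a /\ p = a + 'X_i * b.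
Proof.
move=> ip.
pose Q (m : 'X_{1..n}) := [exists j : 'I_n, (j < i)%N && (m j != 0)%N].
exists (\sum_(m <- msupp p | Q m) p@_m *: 'X_[m]).
exists (\sum_(m <- msupp p | ~~ Q m) p@_m *: 'X_[m - U_(i)]); split.
  apply: (@ideal_sum _ (vars_ideal i)) => [|m Qm]; first exact: vars_idealP.
  rewrite -mul_mpolyC; apply: (ideal_mulr _ (vars_idealP i)).
  by move=> m'; rewrite mcoeffX; have [<-|_] := eqVneq m m'; rewrite ?eqxx.
rewrite {1}[p]mpolyE (bigID Q) /=; congr (_ + _); rewrite mulr_sumr.
rewrite big_seq_cond [RHS]big_seq_cond; apply: eq_bigr => m /andP[mp Qm].
rewrite -scalerAr -mpolyXD addmC submK // lep1mP.
move: mp; rewrite mcoeff_msupp => /ip/existsP[j /andP[]].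
rewrite ltnS leq_eqVlt => /orP[/eqP/val_inj -> //|ji mj].
by case/existsP: Qm; exists j; rewrite ji.
Qed.

(** ['X_i] is a nonzerodivisor modulo the earlier variables: multiplying a monomial by it brings in
    none of them. *)
Lemma vars_ideal_regular (i : 'I_n) p : vars_ideal i ('X_i * p) -> vars_ideal i p.
Proof.
move=> ip m pm; have := ip (U_(i) + m)%MM.
rewrite mulrC mcoeffMX => /(_ pm)/existsP[j /andP[ji]].
rewrite mnmDE mnm1E; have [ij|_] := eqVneq i j; first by rewrite ij ltnn in ji.
by rewrite add0n => mj; apply/existsP; exists j; rewrite ji.
Qed.

Lemma mx_vars_ideal_split (i : 'I_n) k l (M : 'M[S]_(k, l)) :
  mx_in (vars_ideal i.+1) M ->
  exists A B, mx_in (vars_ideal i) A /\ M = A + 'X_i *: B.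
Proof.
move=> iM; pose T s t ab := vars_ideal i ab.1 /\ M s t = ab.1 + 'X_i * ab.2.
have H s t : exists ab, T s t ab.
  by have [a [b ab]] := vars_ideal_split (iM s t); exists (a, b).
exists (\matrix_(s, t) (xget (0, 0) (T s t)).1).
exists (\matrix_(s, t) (xget (0, 0) (T s t)).2).
have Tx s t : T s t (xget (0, 0) (T s t)).
  exact: xgetPex (H s t).
split=> [s t|]; first by rewrite mxE; case: (Tx s t).
by apply/matrixP => s t; rewrite !mxE; case: (Tx s t).
Qed.

(** * Socles of linear complexes *)

(* [D 0] may have any degree [d <= t]. In the induction [z] is replaced by the
   homogeneous [v] with x_r z = v D_0 modulo the first [r] variables, [r] by
   [r.+1], [D] by its shift, and hence [d] by 1 and [t] by [t.+1 - d]. *)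
Lemma linear_complex_socle k r (rk : nat -> nat)
    (D : forall i, 'M[S]_(rk i.+1, rk i)) (d t : nat) (z : 'rV[S]_(rk 0%N)) :
  (r + k)%N = n ->
  (forall i, D i.+1 *m D i = 0) ->
  (forall i (v : 'rV_(rk i.+1)), mx_in (vars_ideal r) (v *m D i) ->
     exists w, mx_in (vars_ideal r) (v - w *m D i.+1)) ->
  (forall i j, D 0%N i j \is d.-homog) ->
  (forall l i j, D l.+1 i j \is 1.-homog) ->
  (0 < t)%N -> (d <= t)%N -> (forall j, z 0 j \is t.-homog) ->
  (forall l : 'I_n, exists v, mx_in (vars_ideal r) ('X_l *: z - v *m D 0%N)) ->
  exists v, mx_in (vars_ideal r) (z - v *m D 0%N).
Proof.
elim: k r rk D d t z => [|k IHk] r rk D d t z.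
  rewrite addn0 => -> _ _ _ _ t0 _ hz _; exists 0 => i j.
  by rewrite mul0mx subr0 ord1; apply: homog_vars_ideal (hz j).
move=> rkn cD eD hD0 hD t0 le_dt hz mz.
have lt_rn : (r < n)%N by rewrite -rkn addnS ltnS leq_addr.
pose x := Ordinal lt_rn.
have iQ : is_ideal (vars_ideal r) := vars_idealP r.
have iQ1 : is_ideal (vars_ideal r.+1) := vars_idealP r.+1.
have QS i j (M : 'M[S]_(i, j)) :
    mx_in (vars_ideal r) M -> mx_in (vars_ideal r.+1) M.
  by move=> QM i' j'; exact: vars_idealS.
have Qreg i j (M : 'M[S]_(i, j)) :
    mx_in (vars_ideal r) ('X_x *: M) -> mx_in (vars_ideal r) M.
  by move=> QM i' j'; have := QM i' j'; rewrite mxE => /(@vars_ideal_regular x).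
have [v0 Qv0] := mz x.
(* As ['X_x *: z] has degree [t.+1] and [D 0] has degree [d], only this component of [v0] matters; a
   monomial ideal contains the components of its elements. *)
pose v := map_mx (pihomog mdeg (t.+1 - d)) v0.
have hv j : v 0 j \is (t.+1 - d).-homog by rewrite mxE pihomogP.
have Qv : mx_in (vars_ideal r) ('X_x *: z - v *m D 0%N).
  move=> i j.
  rewrite (_ : _ i j = pihomog mdeg t.+1 (('X_x *: z - v0 *m D 0%N) i j)).
    move=> m; rewrite mcoeff_pihomog; case: ifP => _; last by rewrite eqxx.
    exact: Qv0.
  rewrite !mxE pihomogB; congr (_ - _).
    by rewrite pihomog_dE // ord1 (dhomogM (d := 1)) // dhomogX /= mdeg1.
  rewrite raddf_sum /=; apply: eq_bigr => s _; rewrite mxE ord1.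
  by rewrite -[t.+1 in RHS](subnK (leqW le_dt)) pihomogM.
have [|||||u Qu] := IHk r.+1 (fun i => rk i.+1) (fun i => D i.+1)
    1%N (t.+1 - d)%N v _ (fun i => cD i.+1) _ (hD 0%N) (fun l => hD l.+1) _ _ hv _.
- by rewrite addSnnS.
(* Exactness survives killing ['X_x]: if [w *m D i.+1] is ['X_x *: B] modulo the earlier variables,
   regularity makes [B] a cycle, hence some [w1 *m D i.+1], and then [w - 'X_x *: w1] is a cycle. *)
- move=> i w /(@mx_vars_ideal_split x _ _ _)[A [B [QA wE]]].
  have [w1 Qw1] : exists w1, mx_in (vars_ideal r) (B - w1 *m D i.+1).
    apply: eD; apply: Qreg; rewrite scalemxAl.
    rewrite (_ : 'X_x *: B = w *m D i.+1 - A); last by rewrite wE addrAC subrr add0r.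
    rewrite mulmxBl -mulmxA cD mulmx0 add0r; apply: mx_inN => //.
    exact: mx_inMr.
  have [w2 Qw2] : exists w2,
      mx_in (vars_ideal r) (w - 'X_x *: w1 - w2 *m D i.+2).
    apply: eD; rewrite mulmxBl wE -scalemxAl -addrA -scalerBr.
    by apply: mx_inD => //; apply: mx_inZ.
  exists w2; rewrite -[w](subrK ('X_x *: w1)) addrAC; apply: mx_inD => //.
    exact: QS.
  by apply: mx_inZl => //; exact: vars_idealX.
- by rewrite subn_gt0 ltnS.
- by rewrite subn_gt0 ltnS.
(* Lifting ['X_l * 'X_x *: z] in two ways shows that ['X_l *: v - 'X_x *: vl] is a cycle modulo the
   earlier variables. *)
- move=> l; have [vl Qvl] := mz l.
  have [w Qw] : exists w,
      mx_in (vars_ideal r) ('X_l *: v - 'X_x *: vl - w *m D 1%N).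
    apply: eD; rewrite mulmxBl -!scalemxAl.
    rewrite (_ : _ - _ = 'X_x *: ('X_l *: z - vl *m D 0%N)
                         - 'X_l *: ('X_x *: z - v *m D 0%N)); last first.
      by rewrite !scalerBr !scalerA ['X_x * _]mulrC opprB [RHS]addrC subrKA.
    by apply: mx_inD => //; last apply: mx_inN => //; exact: mx_inZ.
  exists w; rewrite -['X_l *: v](subrK ('X_x *: vl)) addrAC; apply: mx_inD => //.
    exact: QS.
  by apply: mx_inZl => //; exact: vars_idealX.
(* Applying [D 0] to [v - u *m D 1 = A + 'X_x *: B] gives ['X_x *: z] congruent to
   ['X_x *: (B *m D 0)]; then ['X_x] cancels. *)
have [A [B [QA vE]]] := @mx_vars_ideal_split x _ _ _ Qu.
exists B; apply: Qreg; rewrite scalerBr scalemxAl.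
rewrite (_ : 'X_x *: B = v - u *m D 1%N - A); last by rewrite vE addrAC subrr add0r.
rewrite !mulmxBl -[u *m _ *m _]mulmxA cD mulmx0 subr0 opprB addrCA.
by apply: (mx_inD iQ) => //; exact: (mx_inMr iQ).
Qed.

Lemma linear_resolution_socle (J : set S) (e t : nat)
    (F : graded_free_resolution J) (f : S) :
  (forall i (j : 'I_(gfr_rank F i)), gfr_shift j = (e + i)%:Z) ->
  (0 < t)%N -> (e <= t)%N -> f \is t.-homog ->
  (forall l, J ('X_l * f)) -> J f.
Proof.
move=> sF t0 le_et hf mf.
(* The augmentation becomes [D 0], of degree [e], which shifts the indices of the resolution by
   one. *)
pose rk i := if i is i'.+1 then gfr_rank F i' else 1%N.
pose D i : 'M[S]_(rk i.+1, rk i) :=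
  match i with 0%N => gfr_aug F | i'.+1 => gfr_diff F i' end.
have Q0 k l (M : 'M[S]_(k, l)) : mx_in (vars_ideal 0) M -> M = 0.
  by move=> QM; apply/matrixP => i j; rewrite mxE; exact: vars_ideal0 (QM i j).
have Q0E k l (M : 'M[S]_(k, l)) : M = 0 -> mx_in (vars_ideal 0) M.
  by move=> -> i j; rewrite mxE; case: (vars_idealP 0).
have JE g : J g -> exists v : 'rV_(gfr_rank F 0), (v *m gfr_aug F) 0 0 = g.
  by rewrite -[in X in X -> _](gfr_aug_image F) => -[v _ <-]; exists v.
have exD i (v : 'rV_(rk i.+1)) : v *m D i = 0 -> exists w, v = w *m D i.+1.
  by case: i v => [|i] v /=; [move/gfr_exact0|move/gfr_exact].
have cD i : D i.+1 *m D i = 0.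
  apply/row_matrixP => s; rewrite row_mul row0 rowE.
  by case: i s => [|i] s; [apply/gfr_exact0|apply/gfr_exact]; exists (delta_mx 0 s).
have [||||||v Qv] := @linear_complex_socle n 0 rk D e t (\row__ f) _ cD _ _ _ t0 le_et.
- by [].
- by move=> i v /Q0/exD[w ->]; exists w; apply: Q0E; rewrite subrr.
- move=> i j; have := @gfr_aug_homog _ _ _ F i.
  by rewrite sF addn0 /= [j]ord1.
- move=> l i j; have := @gfr_diff_homog _ _ _ F l i j.
  by rewrite !sF addnS -addn1 PoszD addrAC subrr add0r.
- by move=> j; rewrite mxE.
- move=> l; have [v vE] := JE _ (mf l); exists v; apply: Q0E.
  by apply/matrixP => i j; rewrite ord1 [j]ord1 !mxE -vE mxE subrr.
rewrite -(gfr_aug_image F); exists v => //.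
by have /eqP := Q0 _ _ _ Qv; rewrite subr_eq0 => /eqP <-; rewrite mxE.
Qed.

End Polynomials.

(** * Graded ideals in the localization, and strong persistence *)

(** Elements outside [graded_max] have nonzero constant term, so a graded ideal absorbs them by
    [graded_ideal_unit]. *)
Lemma loc_ideal_graded (K : fieldType) (n : nat) (J : set {mpoly K[n]})
    (a s : {mpoly K[n]}) (Ps : s \notin graded_max K n) :
  is_ideal J -> graded_ideal J -> loc_ideal _ J (loc_frac a Ps) -> J a.
Proof.
move=> iJ gJ /(loc_idealE _ iJ)[b [t [Pt [Jb /loc_frac_eq[u Pu /eqP]]]]].
rewrite mulrBr subr_eq0 => /eqP uat.
apply: (@graded_ideal_unit _ _ _ (u * t)) => //.
  apply: contraNneq (loc_denM Pu Pt) => ut0.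
  exact/asboolP/irrelevant_idealE.
rewrite -mulrA [t * a]mulrC uat mulrA mulrAC; exact: ideal_mulr.
Qed.

Unset Implicit Arguments.

Theorem proposition1p2 (K : fieldType) (n : nat) (hn : (0 < n)%N)
    (I : idealr {mpoly K[n]}) (hgr : graded_ideal [set` I])
    (hlin : forall k : nat, (1 <= k)%N ->
       linear_resolution (ideal_pow [set` I] k)) :
  strong_persistence I (graded_max K n).
Proof.
pose I' : set {mpoly K[n]} := [set` I].
have iI : is_ideal I' by exact: idealr_is_ideal.
rewrite /strong_persistence; cbv zeta => k k1 f; rewrite !loc_ideal_pow //.
pose J := ideal_pow I' k; rewrite -/I' -/J => mf nf.
have iJ : is_ideal J by exact: ideal_pow_ideal.
have [e [Je [F [_ sF]]]] := hlin k k1.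
have gJ : graded_ideal J := generated_in_degree_graded Je.
have [a [s [Ps fE]]] := loc_frac_surj f.
have Ja : ~ J a by move=> Ja; apply: nf; apply/loc_idealE => //; exists a, s, Ps.
have JaX (l : 'I_n) : J (a * 'X_l).
  have /mf : loc_max (graded_max K n) (loc_of _ ('X_l : {mpoly K[n]})).
    apply: sub_ideal_gen; exists 'X_l => //=; apply/asboolP.
    by apply: sub_ideal_gen; exists l.
  by rewrite fE [_ * _]loc_frac_mul => /(loc_ideal_graded iJ gJ).
have X0 (l : 'I_n) : 'X_l != 0 :> {mpoly K[n]}.
  by rewrite -msupp_eq0 msuppX.
pose x := Ordinal hn.
(* A nonzero element of [J], and later of [I'], from which nonzero forms of generating degree are
   obtained. *)
have aX0 : a * 'X_x != 0.
  by rewrite mulf_neq0 ?X0 //; apply/eqP => a0; apply: Ja; rewrite a0; case: iJ.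
(* If [e] were 0, [J] would contain a nonzero constant, hence [a]. *)
have e0 : (0 < e)%N.
  rewrite lt0n; apply/eqP => e0; apply: Ja.
  have [g [Jg hg g0]] := generated_in_degree_neq0 Je (JaX x) aX0.
  apply: (@graded_ideal_unit _ _ _ g) => //; last first.
    by rewrite mulrC; apply: ideal_mulr.
  apply: contraNneq g0 => g00; rewrite e0 in hg.
  rewrite (@homog_order_ideal_eq0 _ _ 0 1 g) // => m.
  by rewrite lt0n mdeg_eq0; apply: contraNneq => ->; rewrite g00.
have hX (l : 'I_n) : ('X_l : {mpoly K[n]}) \is 1.-homog.
  by rewrite dhomogX /= mdeg1.
have JXa t l : J (pihomog mdeg t a * 'X_l).
  by rewrite -(pihomogM _ _ (hX l)); exact: gJ.
(* From degree [e] on this is the socle lemma; below [e.-1], multiplying by ['X_x] gives a form in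
   [J] of degree less than [e], hence zero. *)
have Jat t : t != e.-1 -> J (pihomog mdeg t a).
  move=> te; have [le_et|lt_te] := leqP e t.
    apply: (linear_resolution_socle sF (leq_trans e0 le_et) le_et).
      exact: pihomogP.
    by move=> l; rewrite mulrC; exact: JXa.
  suff : pihomog mdeg t a * 'X_x == 0.
    by rewrite mulf_eq0 (negPf (X0 x)) orbF => /eqP ->; case: iJ.
  apply/eqP; apply: (@homog_order_ideal_eq0 _ _ (t + 1)%N e).
  - by rewrite dhomogM ?pihomogP.
  - exact: generated_in_degree_order Je _ (JXa t x).
  - by rewrite addn1 ltn_neqAle lt_te andbT; apply: contraNneq te => <-.
pose c := pihomog mdeg e.-1 a.
have Jac : J (a - c).
  apply: (graded_ideal_in iJ) => t; rewrite pihomogB.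
  have [->|te] := eqVneq t e.-1; first by rewrite pihomog_id subrr; case: iJ.
  rewrite [X in _ - X](@pihomog_ne0 _ _ _ e.-1) ?pihomogP 1?eq_sym //.
  by rewrite subr0; exact: Jat.
have c0 : c != 0 by apply/eqP => c0; rewrite c0 subr0 in Jac.
(* The first power is the product of [I'] with the whole ring; this identification gives the
   generating degree [d] of [I'] itself. *)
have I1 : ideal_pow I' 1 = I'.
  apply/seteqP; split; first exact: ideal_pow_sub.
  by move=> p Ip; rewrite -[p]mulr1; exact: mem_ideal_mul.
have [d [Id _]] := hlin 1%N isT; rewrite -/I' I1 in Id.
have IaX : I' (a * 'X_x).
  by move: (JaX x); rewrite /J -(prednK k1); exact: ideal_pow_sub.
have [g [Ig hg g0]] := generated_in_degree_neq0 Id IaX aX0.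
exists (loc_of _ g); first by apply: sub_ideal_gen; exists g.
(* The next power is graded too, so a fraction in its localization has its numerator [a * g] in
   it. *)
have [e' [Je' _]] := hlin k.+1 isT.
have iJ' : is_ideal (ideal_pow I' k.+1) by exact: ideal_pow_ideal.
rewrite fE [_ * _]loc_frac_mul.
move=> /(loc_ideal_graded iJ' (generated_in_degree_graded Je')) J'ag.
suff : c * g == 0 by rewrite mulf_eq0 (negPf c0) (negPf g0).
apply/eqP; apply: (@homog_order_ideal_eq0 _ _ (e.-1 + d)%N (d + e)%N).
- by rewrite dhomogM ?pihomogP.
(* Since [a - c] lies in [J] and [g] in [I'], replacing [a] by [c] keeps the product in the power
   [k.+1], whose order is at least [d + e]. *)
- have J'cg : ideal_pow I' k.+1 (c * g).
    rewrite -[c](subKr a) mulrBl; apply: (ideal_sub iJ') => //.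
    by rewrite mulrC; exact: mem_ideal_mul.
  suff : ideal_pow I' k.+1 `<=` order_ideal (d + e)%N by exact.
  apply: ideal_gen_sub; first exact: order_idealP.
  move=> _ [p Ip [q Jq <-]]; apply: order_idealM.
    exact: generated_in_degree_order Id _ Ip.
  exact: generated_in_degree_order Je _ Jq.
- by rewrite addnC ltn_add2l prednK.
Qed.
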